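(* Let $p$ be a prime, let $P$ be a finite $p$-group, and let $\mathcal F$ be an extremely sparse fusion system on $P$. Then $\mathcal F$ is constrained.
   Context: Fusion systems. Let $\mathcal{F}$ be a category whose objects are the subgroups of $P$, where $\mathrm{Hom}_{\mathcal F}(Q,R)$ is a set of injective group homomorphisms $Q\to R$ and composition is composition of maps. Write $Q^{\mathcal F}$ for the $\mathcal F$-isomorphism class of $Q$, $\mathrm{Hom}_P(Q,R)$ for the homomorphisms $Q\to R$ induced by conjugation by elements of $P$, and $\mathrm{Aut}_P(Q)$ for the automorphisms of $Q$ induced by conjugation by elements of $\mathrm N_P(Q)$. A subgroup $Q$ is fully $\mathcal F$-normalized if $|\mathrm N_P(Q)|\ge|\mathrm N_P(R)|$ for all $R\in Q^{\mathcal F}$. $\mathcal F$ is a saturated fusion system on $P$ if for all $Q,R\le P$: (a) if $Q\le R$, the inclusion $Q\to R$ is in $\mathcal F$; (b) if $\phi\in\mathrm{Hom}_{\mathcal F}(Q,R)$, then the induced isomorphism $Q\to\phi(Q)$ and its inverse are in $\mathcal F$; (c) $\mathrm{Hom}_P(Q,R)\subseteq\mathrm{Hom}_{\mathcal F}(Q,R)$; (d) $\mathrm{Aut}_P(P)$ is a Sylow $p$-subgroup of $\mathrm{Aut}_{\mathcal F}(P)$; (e) every $\phi\in\mathrm{Hom}_{\mathcal F}(Q,P)$ with $\phi(Q)$ fully $\mathcal F$-normalized extends to a morphism in $\mathrm{Hom}_{\mathcal F}(N_\phi,P)$, where $N_\phi$ is the inverse image in $\mathrm N_P(Q)$ of $\mathrm{Aut}_P(Q)\cap(\phi^{-1}\mathrm{Aut}_P(\phi(Q))\phi)$.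 For a finite $p$-group $Q$, $\mathcal F_Q(Q)$ is the fusion system on $Q$ whose morphisms are exactly those induced by conjugation by elements of $Q$. $\mathcal F$ is trivial if $\mathcal F=\mathcal F_P(P)$. A saturated subsystem of $\mathcal F$ on $Q\le P$ is a subcategory of $\mathcal F$ which is a saturated fusion system on $Q$. A nontrivial saturated fusion system $\mathcal F$ on $P$ is extremely sparse if, for every subgroup $Q\le P$, the only proper (i.e. $\neq\mathcal F$) saturated subsystem of $\mathcal F$ on $Q$ is $\mathcal F_Q(Q)$. For $Q\le P$, $\mathrm N_{\mathcal F}(Q)$ has objects the subgroups of $\mathrm N_P(Q)$ and morphisms $R\to S$ those $\phi\in\mathrm{Hom}_{\mathcal F}(R,S)$ for which there is $\varphi\in\mathrm{Hom}_{\mathcal F}(QR,QS)$ with $\varphi|_R=\phi$ and $\varphi(Q)=Q$. $Q$ is normal in $\mathcal F$ if $\mathrm N_{\mathcal F}(Q)=\mathcal F$. $Q$ is $\mathcal F$-centric if $\mathrm C_P(R)\le R$ for all $R\in Q^{\mathcal F}$. $\mathcal F$ is constrained if some $\mathcal F$-centric subgroup of $P$ is normal in $\mathcal F$. *)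

(* Defs.v *)
From mathcomp Require Import all_boot all_fingroup.
From mathcomp Require Import pgroup.

Set Implicit Arguments.
Unset Strict Implicit.
Unset Printing Implicit Defensive.

Import GroupScope.

(* A homomorphism Q -> R between subgroups of gT is encoded by the unique     *)
(* {ffun gT -> gT} that agrees with it on Q and is 1 outside Q, so that       *)
(* equality of morphisms with the same source and target is Leibniz equality. *)
(* The source and target are carried by the indices of the hom-sets; a map    *)
(* Q -> R and the map Q -> S with the same values are the same ffun.          *)
(* The family F below stands for a category whose objects are the subgroups   *)
(* of some group P; only the values F Q R with Q, R \subset P are meaningful. *)

Section FusionSystems.

Variable gT : finGroupType.
Implicit Types (A : {set gT}) (P Q R S : {group gT}).

Definition hom_family := {group gT} -> {group gT} -> {set {ffun gT -> gT}}.

Implicit Types (F E : hom_family) (f g : {ffun gT -> gT}).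

Definition restr A (f : gT -> gT) : {ffun gT -> gT} :=
  [ffun x => if x \in A then f x else 1].

(* Both the identity of Q and the inclusion of Q in an overgroup.             *)
Definition incl Q : {ffun gT -> gT} := restr Q id.

Definition injhoms Q R : {set {ffun gT -> gT}} :=
  [set f : {ffun gT -> gT} |
    [&& morphic Q f, dinjectiveb f Q, f @: Q \subset R & f == restr Q f]].

Record is_category P F : Prop := IsCategory {
  cat_hom : forall Q R, Q \subset P -> R \subset P ->
    F Q R \subset injhoms Q R;
  cat_id : forall Q, Q \subset P -> incl Q \in F Q Q;
  cat_comp : forall Q R S f g,
    Q \subset P -> R \subset P -> S \subset P ->
    f \in F Q R -> g \in F R S -> restr Q (g \o f) \in F Q S
}.

Definition same_on P F E : Prop :=
  forall Q R, Q \subset P -> R \subset P -> F Q R = E Q R.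

Definition mutual_inverse Q R f g : bool :=
  (restr Q (g \o f) == incl Q) && (restr R (f \o g) == incl R).

Definition iso_class P F Q : {set {group gT}} :=
  [set R : {group gT} | (R \subset P)
    && [exists f in F Q R, [exists g in F R Q, mutual_inverse Q R f g]]].

Definition conj_homs P Q R : {set {ffun gT -> gT}} :=
  [set restr Q (conjg^~ x) | x in P & Q :^ x \subset R].

(* Automorphisms of Q are the elements of Aut Q : {set {perm gT}}, which fix  *)
(* every point outside Q; a : {perm gT} in Aut Q corresponds to restr Q a.    *)
Definition Aut_conj P Q : {set {perm gT}} := conj_aut Q @* 'N_P(Q).

Definition Aut_fus F Q : {set {perm gT}} :=
  [set a in Aut Q | restr Q a \in F Q Q].

Definition fully_normalized P F Q : bool :=
  [forall R in iso_class P F Q, #|'N_P(R)| <= #|'N_P(Q)|].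

Definition im_group Q f : {group gT} := [group of <<f @: Q>>].

Lemma im_groupE Q R f : f \in injhoms Q R -> im_group Q f = f @: Q :> {set gT}.
Proof.
rewrite inE => /and4P[/morphicP fM _ _ _]; apply/gen_set_id/group_setP; split.
  apply/imsetP; exists 1 => //; apply: (mulgI (f 1)).
  by rewrite mulg1 -fM ?mulg1.
move=> _ _ /imsetP[x Qx ->] /imsetP[y Qy ->].
by rewrite -fM // imset_f // groupM.
Qed.

(* The set f^-1 Aut_P(f(Q)) f of automorphisms of Q: those b for which        *)
(* f b = a f on Q for some a in Aut_P(f(Q)).                                  *)
Definition Aut_pullback P Q f : {set {perm gT}} :=
  [set b in Aut Q | [exists a in Aut_conj P (im_group Q f),
                      [forall x in Q, f (b x) == a (f x)]]].

(* The subgroup N_f of 'N_P(Q).                                               *)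
Definition extender P Q f : {set gT} :=
  [set x in 'N_P(Q) | conj_aut Q x \in Aut_conj P Q :&: Aut_pullback P Q f].

Lemma extender_group_set P Q f : group_set (extender P Q f).
Proof.
apply/group_setP; split=> [|x y].
  rewrite inE group1 morph1 inE group1 inE group1 /=.
  apply/exists_inP; exists 1; first exact: group1.
  by apply/forall_inP => x _; rewrite !perm1.
rewrite 2!inE => /andP[NPx]; rewrite 2!inE => /and3P[Ax AutQx].
case/exists_inP=> a Aa /forall_inP fa.
rewrite 2!inE => /andP[NPy]; rewrite 2!inE => /and3P[Ay AutQy].
case/exists_inP=> b Ab /forall_inP fb.
have [[Px Nx] [Py Ny]] := (andP NPx, andP NPy).
have cM: conj_aut Q (x * y) = conj_aut Q x * conj_aut Q y by rewrite morphM.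
rewrite inE inE groupM // groupM //= cM inE groupM //= inE groupM //=.
apply/exists_inP; exists (a * b); first exact: groupM.
apply/forall_inP => z Qz; rewrite !permM -(eqP (fa z Qz)).
exact/fb/Aut_closed.
Qed.

Canonical extender_group P Q f := Group (extender_group_set P Q f).

Record saturated (p : nat) P F : Prop := Saturated {
  sat_category : is_category P F;
  sat_incl : forall Q R, R \subset P -> Q \subset R -> incl Q \in F Q R;
  sat_iso : forall Q R f, Q \subset P -> R \subset P -> f \in F Q R ->
    f \in F Q (im_group Q f)
    /\ exists2 g, g \in F (im_group Q f) Q
                & mutual_inverse Q (im_group Q f) f g;
  sat_conj : forall Q R, Q \subset P -> R \subset P ->
    conj_homs P Q R \subset F Q R;
  sat_Sylow : p.-Sylow(Aut_fus F P) (Aut_conj P P);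
  sat_extend : forall Q f, Q \subset P -> f \in F Q P ->
    fully_normalized P F (im_group Q f) ->
    exists2 g, g \in F (extender_group P Q f) P & restr Q g = f
}.

Definition sat_subsystem p P F Q E : Prop :=
  [/\ Q \subset P, saturated p Q E
    & forall R S, R \subset Q -> S \subset Q -> E R S \subset F R S].

(* The system conj_homs Q is F_Q(Q). A subsystem on Q differs from F as soon  *)
(* as Q differs from P, since it then has fewer objects.                      *)
Definition extremely_sparse p P F : Prop :=
  [/\ saturated p P F, ~ same_on P F (conj_homs P)
    & forall Q E, sat_subsystem p P F Q E -> ~ (Q = P /\ same_on P E F) ->
        same_on Q E (conj_homs Q)].

(* The objects of N_F(Q) are the subgroups of 'N_P(Q); these normalize Q, so  *)
(* the join Q <*> R is the product Q * R.                                     *)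
Definition normalizer_system F Q : hom_family := fun R S =>
  [set f in F R S | [exists g in F (Q <*> R)%G (Q <*> S)%G,
                      (restr R g == f) && (g @: Q == Q)]].

Definition normal_in P F Q : Prop :=
  [/\ Q \subset P, 'N_P(Q) = P & same_on P (normalizer_system F Q) F].

Definition centric P F Q : Prop :=
  Q \subset P /\ forall R, R \in iso_class P F Q -> 'C_P(R) \subset R.

Definition constrained P F : Prop :=
  exists2 Q, centric P F Q & normal_in P F Q.

End FusionSystems.

(* Main.v *)
Require Import Defs.
From mathcomp Require Import all_boot all_fingroup.
From mathcomp Require Import pgroup nilpotent sylow.

(** An extremely sparse system [F] on [P] turns out to have [P] itself as a
    normal subgroup, and [P] is always [F]-centric.

    The nontriviality of [F] must show up in a single automizer: by Frobenius'
    criterion ([Frobenius_trivial]), if [F] is saturated and the group of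
    [F]-automorphisms of every subgroup of [P] is a p-group, then [F] is the
    system of [P]. This is a descending induction on the order of the source
    [Q] of a morphism. If a proper subgroup [R] is fully normalized, then an
    [F]-automorphism of [R] normalizing the automizer of [R] in [P] extends to
    the normalizer of [R] in [P]; this is larger than [R], so the extension is
    a conjugation in [P] by induction. Hence that automizer is self-normalizing
    in a p-group and equals the group of all [F]-automorphisms of [R]
    ([fully_normalized_Aut_fus]). Every morphism onto [R] now extends to the
    normalizer of its source, so is again a conjugation, and an arbitrary
    morphism is a quotient of two morphisms onto a common fully normalized [R].

    So some [Q] has a nontrivial [F]-automorphism [a] of order prime to p. Let
    [A] be generated by [a] and the inner automorphisms of [Q]. The restrictions
    of elements of [A] form a saturated system on [Q]
    ([aut_system_saturated]): the inner automorphisms are a normal Sylow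
    subgroup of [A], and morphisms extend because each of them is by
    construction the restriction of an automorphism of [Q]. The system is
    nontrivial because of [a], so extreme sparsity forces it to be [F], whence
    [Q = P] and all of [F] consists of restrictions of automorphisms of [P]
    ([extremely_sparse_aut], [constrained_aut_system]). *)

Set Implicit Arguments.
Unset Strict Implicit.
Unset Printing Implicit Defensive.

Import GroupScope.

(** * Values of restricted maps *)

Section Restriction.

Variable gT : finGroupType.
Implicit Types (A : {set gT}) (Q R S : {group gT}) (f g : gT -> gT).

Lemma restrE A f x : x \in A -> restr A f x = f x.
Proof. by move=> Ax; rewrite ffunE Ax. Qed.

Lemma eq_in_restr A f g : {in A, f =1 g} -> restr A f = restr A g.
Proof. by move=> fg; apply/ffunP=> x; rewrite !ffunE; case: ifP => // /fg. Qed.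

Lemma restr_eq_in A f g : restr A f = restr A g -> {in A, f =1 g}.
Proof. by move=> fg x Ax; rewrite -(restrE f Ax) fg restrE. Qed.

Lemma imset_restr A f : restr A f @: A = f @: A.
Proof. by apply: eq_in_imset => x /restrE. Qed.

Lemma injhomsP Q R (f : {ffun gT -> gT}) :
  reflect [/\ {in Q &, {morph f : x y / x * y}}, {in Q &, injective f},
              f @: Q \subset R & restr Q f = f]
          (f \in injhoms Q R).
Proof.
rewrite inE; apply: (iffP and4P) => [] [fM fI fR fE]; split=> //.
- exact/morphicP.
- exact/dinjectiveP.
- by rewrite -(eqP fE).
- exact/morphicP.
- exact/dinjectiveP.
- by rewrite fE.
Qed.

Lemma restr_Aut_injhoms Q R S (a : {perm gT}) :
  a \in Aut Q -> R \subset Q -> a @: R \subset S -> restr R a \in injhoms R S.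
Proof.
move=> Aa /subsetP sRQ aRS; apply/injhomsP; split.
- move=> x y Rx Ry; rewrite !restrE ?groupM //.
  by rewrite (morphicP (Aut_morphic Aa)) ?sRQ.
- by move=> x y Rx Ry; rewrite !restrE //; apply: perm_inj.
- by rewrite imset_restr.
- by apply: eq_in_restr => x; apply: restrE.
Qed.

(** The automorphism must be produced as a permutation of the whole type,
    because the automizers of the theory consist of such permutations. *)
Lemma injhoms_Aut Q (f : {ffun gT -> gT}) :
  f \in injhoms Q Q -> exists2 a : {perm gT}, a \in Aut Q & restr Q a = f.
Proof.
case/injhomsP=> fM fI fQ fE; exists (perm_in fI fQ).
  rewrite inE perm_in_on; apply/morphicP=> x y Qx Qy.
  by rewrite !perm_inE ?groupM // fM.
by rewrite -[RHS]fE; apply: eq_in_restr; apply: perm_inE.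
Qed.

Lemma im_group_sub Q R (f : {ffun gT -> gT}) :
  f @: Q \subset R -> im_group Q f \subset R.
Proof. by rewrite gen_subG. Qed.

Lemma im_group_Aut Q (a : {perm gT}) :
  a \in Aut Q -> im_group Q (restr Q a) = Q.
Proof.
move=> Aa; apply: val_inj; rewrite /= imset_restr.
by rewrite -(autmE Aa) -morphimEdom im_autm genGid.
Qed.

End Restriction.

(** * Inner automorphisms *)

Section Inner.

Variable gT : finGroupType.
Implicit Types P Q : {group gT}.

Lemma Aut_conj_sub_Aut P Q : Aut_conj P Q \subset Aut Q.
Proof. exact: subset_trans (morphimS _ (subsetIr _ _)) (Aut_conj_aut _ _). Qed.

Lemma pgroup_Aut_conj p P Q : p.-group P -> p.-group (Aut_conj P Q).
Proof. by move=> pP; apply/morphim_pgroup/(pgroupS (subsetIl _ _) pP). Qed.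

Lemma Aut_conjP P Q (a : {perm gT}) :
  reflect (exists2 x, x \in 'N_P(Q) & a = conj_aut Q x) (a \in Aut_conj P Q).
Proof.
apply: (iffP imsetP) => [] [x Nx ->]; exists x => //.
  by case/setIP: Nx.
by rewrite inE Nx (subsetP (subsetIr P _) x Nx).
Qed.

Lemma Aut_conj_restr P Q (a : {perm gT}) x :
    a \in Aut Q -> x \in P -> restr Q a = restr Q (conjg^~ x) ->
  a \in Aut_conj P Q.
Proof.
move=> Aa Px /restr_eq_in ax; have Nx: x \in 'N(Q).
  apply/normP; rewrite -[RHS](im_autm Aa) morphimEdom.
  by apply: eq_in_imset => z /ax.
apply/Aut_conjP; exists x; first by rewrite inE Px.
apply: (eq_Aut Aa) => [|z Qz]; last by rewrite norm_conj_autE // ax.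
by rewrite (subsetP (Aut_conj_aut _ 'N(Q))) // mem_morphim.
Qed.

(** Every automorphism [a] carries conjugation by [x] to conjugation by
    [a x]. *)
Lemma Aut_norm_inner Q : Aut Q \subset 'N(Aut_conj Q Q).
Proof.
apply/subsetP=> a Aa; rewrite inE; apply/subsetP=> _ /imsetP[b Ab ->].
have [x /setIP[Qx Nx] def_b] := Aut_conjP _ _ _ Ab.
have Qax: a x \in Q by apply: Aut_closed.
have Nax: a x \in 'N(Q) by rewrite (subsetP (normG Q)).
apply/Aut_conjP; exists (a x); first by rewrite inE Qax.
apply: (@eq_Aut _ Q); first by rewrite groupJ // (subsetP (Aut_conj_sub_Aut Q Q)).
  by rewrite (subsetP (Aut_conj_aut _ 'N(Q))) // mem_morphim.
move=> z Qz; have Qw: a^-1 z \in Q by apply: Aut_closed; rewrite ?groupV.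
have aM := morphicP (Aut_morphic Aa).
have aV: a x^-1 = (a x)^-1.
  by apply: (mulgI (a x)); rewrite -aM ?groupV // !mulgV -(autmE Aa) morph1.
rewrite norm_conj_autE // !permM def_b norm_conj_autE // !conjgE.
by rewrite !aM ?groupM ?groupV // aV permKV.
Qed.

(** Works with elements of [P], where the definition of the extender speaks of
    the automorphisms that they induce. *)
Lemma mem_extender P Q R (f : {ffun gT -> gT}) x y :
    f \in injhoms Q R -> x \in 'N_P(Q) -> y \in 'N_P(im_group Q f) ->
    {in Q, forall z, f (z ^ x) = f z ^ y} ->
  x \in extender P Q f.
Proof.
move=> fQR NPx NPy fxy; have [Nx Ny] := (setIP NPx, setIP NPy).
rewrite inE NPx inE /=; apply/andP; split; first by apply/Aut_conjP; exists x.
rewrite inE (subsetP (Aut_conj_sub_Aut P Q)); last by apply/Aut_conjP; exists x.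
apply/exists_inP; exists (conj_aut (im_group Q f) y).
  by apply/Aut_conjP; exists y.
apply/forall_inP=> z Qz; rewrite norm_conj_autE ?(proj2 Nx) // fxy //.
by rewrite norm_conj_autE ?(proj2 Ny) // (im_groupE fQR) imset_f.
Qed.

Lemma sub_extender P Q (f : {ffun gT -> gT}) :
  Q \subset P -> f \in injhoms Q P -> Q \subset extender P Q f.
Proof.
move=> /subsetP sQP fQP; have [fM _ /subsetP fP _] := injhomsP _ _ _ fQP.
have f1: f 1 = 1 by apply: (mulgI (f 1)); rewrite -fM ?mulg1.
apply/subsetP=> x Qx; have fV: f x^-1 = (f x)^-1.
  by apply: (mulgI (f x)); rewrite -fM ?groupV // !mulgV.
apply: (mem_extender (y := f x) fQP).
- by rewrite inE sQP ?(subsetP (normG Q)).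
- rewrite inE fP ?imset_f // (subsetP (normG _)) //.
  by rewrite (im_groupE fQP) imset_f.
- by move=> z Qz; rewrite !conjgE !fM ?groupM ?groupV // fV.
Qed.

End Inner.

(** * The system of restrictions of a group of automorphisms *)

Section AutSystem.

Variable gT : finGroupType.
Implicit Types Q R S : {group gT}.

(** For [A] containing the inner automorphisms of [Q], and [Q] normal in a
    group inducing exactly [A] on [Q], this is the fusion system of that group
    on [Q]; e.g. the fusion system of a semidirect product of [Q] with a
    p'-group of automorphisms. *)
Definition aut_system (A : {set {perm gT}}) : hom_family gT :=
  fun R S => [set restr R a | a : {perm gT} in A & a @: R \subset S].

Lemma aut_systemP (A : {set {perm gT}}) R S (f : {ffun gT -> gT}) :
  reflect (exists a : {perm gT}, [/\ a \in A, a @: R \subset S & f = restr R a])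
          (f \in aut_system A R S).
Proof.
apply: (iffP imsetP) => [[a /[!inE] /andP[Aa aRS] ->] | [a [Aa aRS ->]]].
  by exists a.
by exists a; rewrite ?inE ?Aa.
Qed.

Lemma aut_system_category Q (A : {group {perm gT}}) :
  A \subset Aut Q -> is_category Q (aut_system A).
Proof.
move/subsetP=> sAQ; split.
- move=> R S sRQ _; apply/subsetP=> f /aut_systemP[a [Aa aRS ->]].
  exact: restr_Aut_injhoms (sAQ a Aa) sRQ aRS.
- move=> R _; apply/aut_systemP; exists 1; split=> //.
    by apply/subsetP=> _ /imsetP[x Rx ->]; rewrite perm1.
  by apply: eq_in_restr => x _; rewrite perm1.
- move=> R S T f g _ _ _ /aut_systemP[a [Aa aRS ->]] /aut_systemP[b [Ab bST ->]].
  have aS x : x \in R -> a x \in S by move=> Rx; apply/(subsetP aRS)/imset_f.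
  apply/aut_systemP; exists (a * b); split; first exact: groupM.
    apply/subsetP=> _ /imsetP[x Rx ->]; rewrite permM.
    exact/(subsetP bST)/imset_f/aS.
  by apply: eq_in_restr => x Rx /=; rewrite permM !restrE ?aS.
Qed.

Lemma Aut_fus_aut_system Q (A : {group {perm gT}}) :
  A \subset Aut Q -> Aut_fus (aut_system A) Q = A.
Proof.
move/subsetP=> sAQ; apply/setP=> a; rewrite inE; apply/andP/idP.
  case=> Aa /aut_systemP[b [Ab _ /restr_eq_in ab]].
  by rewrite (eq_Aut Aa (sAQ b Ab) ab).
move=> Aa; have AQa := sAQ a Aa; split=> //.
apply/aut_systemP; exists a; split=> //.
by rewrite -(autmE AQa) -morphimEdom im_autm.
Qed.

(** The extension axiom is immediate: every morphism is the restriction of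
    an automorphism of the whole of [Q], hence extends to any subgroup. *)
Lemma aut_system_saturated p Q (A : {group {perm gT}}) :
    A \subset Aut Q -> p.-Sylow(A) (Aut_conj Q Q) ->
  saturated p Q (aut_system A).
Proof.
move=> sAQ sylA; have catA := aut_system_category sAQ; split=> //.
- move=> R S _ sRS; apply/aut_systemP; exists 1; split=> //.
    by apply/subsetP=> _ /imsetP[x Rx ->]; rewrite perm1 (subsetP sRS).
  by apply: eq_in_restr => x _; rewrite perm1.
- move=> R S f sRQ sSQ fRS.
  have imE := im_groupE (subsetP (cat_hom catA sRQ sSQ) f fRS).
  case/aut_systemP: fRS imE => a [Aa aRS ->]; rewrite imset_restr => imE.
  have aR x : x \in R -> a x \in im_group R (restr R a).
    by move=> Rx; rewrite imE imset_f.
  split; first by apply/aut_systemP; exists a; rewrite imE; split.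
  exists (restr (im_group R (restr R a)) a^-1).
    apply/aut_systemP; exists a^-1; split; rewrite ?groupV // imE.
    by apply/subsetP=> _ /imsetP[_ /imsetP[x Rx ->] ->]; rewrite permK.
  apply/andP; split; apply/eqP/eq_in_restr.
    by move=> x Rx /=; rewrite (restrE a) // restrE ?aR // permK.
  move=> y; rewrite imE => /imsetP[x Rx ->] /=.
  by rewrite (restrE a^-1) ?imset_f // (permK a) restrE.
- move=> R S sRQ sSQ; apply/subsetP=> _ /imsetP[x /[!inE] /andP[Qx RxS] ->].
  have Nx := subsetP (normG Q) x Qx.
  have cE: {in R, conj_aut Q x =1 conjg^~ x}.
    by move=> z Rz; rewrite norm_conj_autE ?(subsetP sRQ).
  apply/aut_systemP; exists (conj_aut Q x); split.
  + apply: (subsetP (pHall_sub sylA)).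
    by apply/Aut_conjP; exists x; rewrite // inE Qx.
  + by rewrite (eq_in_imset cE).
  + by apply: eq_in_restr => z /cE.
- by rewrite Aut_fus_aut_system.
- move=> R f sRQ /aut_systemP[a [Aa aRQ ->]] _.
  have sNQ: extender_group Q R (restr R a) \subset Q.
    by apply/subsetP=> x; rewrite inE => /andP[/setIP[]].
  have sRN: R \subset extender_group Q R (restr R a).
    apply: sub_extender => //; apply: (restr_Aut_injhoms (Q := Q)) => //.
    exact: (subsetP sAQ).
  exists (restr (extender_group Q R (restr R a)) a).
    apply/aut_systemP; exists a; split=> //.
    apply/subsetP=> _ /imsetP[x Nx ->].
    by apply: Aut_closed; rewrite ?(subsetP sAQ) ?(subsetP sNQ).
  by apply: eq_in_restr => x Rx; rewrite restrE ?(subsetP sRN).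
Qed.

End AutSystem.


(** * Morphisms of a saturated fusion system *)

Section Saturated.

Variables (gT : finGroupType) (p : nat) (P : {group gT}) (F : hom_family gT).
Implicit Types (Q R S : {group gT}) (f g : {ffun gT -> gT}).

Hypothesis satF : saturated p P F.

Let catF := sat_category satF.

Lemma fus_injhoms Q R f :
  Q \subset P -> R \subset P -> f \in F Q R -> f \in injhoms Q R.
Proof. by move=> sQP sRP; apply/subsetP/(cat_hom catF). Qed.

Lemma fus_sub Q R f :
  Q \subset P -> R \subset P -> f \in F Q R -> f @: Q \subset R.
Proof. by move=> sQP sRP /(fus_injhoms sQP sRP)/injhomsP[]. Qed.

Lemma fus_widen Q R S f :
  Q \subset P -> S \subset P -> R \subset S -> f \in F Q R -> f \in F Q S.
Proof.
move=> sQP sSP sRS fQR; have sRP := subset_trans sRS sSP.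
have := cat_comp catF sQP sRP sSP fQR (sat_incl satF sSP sRS).
have [_ _ /subsetP fR fE] := injhomsP _ _ _ (fus_injhoms sQP sRP fQR).
rewrite (@eq_in_restr _ Q _ f) ?fE // => x Qx /=.
by rewrite restrE ?fR ?imset_f.
Qed.

Lemma fus_restrict Q R S f :
  Q \subset P -> S \subset P -> R \subset Q -> f \in F Q S ->
  restr R f \in F R S.
Proof.
move=> sQP sSP sRQ fQS; have sRP := subset_trans sRQ sQP.
have := cat_comp catF sRP sQP sSP (sat_incl satF sQP sRQ) fQS.
by rewrite (@eq_in_restr _ R _ f) // => x Rx /=; rewrite restrE.
Qed.

Lemma fus_into Q R S f :
    Q \subset P -> S \subset P -> R \subset P -> f \in F Q S ->
    f @: Q \subset R ->
  f \in F Q R.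
Proof.
move=> sQP sSP sRP fQS fR; have [fim _] := sat_iso satF sQP sSP fQS.
exact: fus_widen (im_group_sub fR) fim.
Qed.

Lemma Aut_fus_group_set Q : Q \subset P -> group_set (Aut_fus F Q).
Proof.
move=> sQP; apply/group_setP; split=> [|a b].
  rewrite inE group1 (@eq_in_restr _ Q _ id) ?(cat_id catF) // => x _.
  by rewrite perm1.
case/setIdP=> Aa aF /setIdP[Ab bF]; apply/setIdP; split; first exact: groupM.
have := cat_comp catF sQP sQP sQP aF bF.
rewrite (@eq_in_restr _ Q _ (a * b)) // => x Qx /=.
by rewrite permM (restrE a) // restrE ?Aut_closed.
Qed.

Lemma Aut_conj_sub_fus Q : Q \subset P -> Aut_conj P Q \subset Aut_fus F Q.
Proof.
move=> sQP; apply/subsetP=> a Aa; rewrite inE.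
rewrite (subsetP (Aut_conj_sub_Aut P Q)) //=.
have [x NPx def_a] := Aut_conjP _ _ _ Aa; have [Px Nx] := setIP NPx.
rewrite (@eq_in_restr _ Q _ (conjg^~ x)) => [|z Qz]; last first.
  by rewrite def_a norm_conj_autE.
apply/(subsetP (sat_conj satF sQP sQP))/imsetP.
by exists x; rewrite // inE Px (normP Nx) /=.
Qed.

Lemma aut_system_sub Q (A : {set {perm gT}}) R S :
    Q \subset P -> A \subset Aut_fus F Q -> R \subset Q -> S \subset Q ->
  aut_system A R S \subset F R S.
Proof.
move=> sQP sAF sRQ sSQ; have [sRP sSP] := (subset_trans sRQ sQP, subset_trans sSQ sQP).
apply/subsetP=> _ /aut_systemP[a [/(subsetP sAF)/setIdP[_ aF] aRS ->]].
have := fus_restrict sQP sQP sRQ aF.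
rewrite (@eq_in_restr _ R _ a) => [aR|x Rx]; last by rewrite restrE ?(subsetP sRQ).
by apply: fus_into aR _; rewrite ?imset_restr.
Qed.

(** Only surjectivity of one morphism has to be known, since the inverse of
    an isomorphism onto the image is again a morphism. *)
Lemma iso_classP Q R :
    Q \subset P ->
  reflect (exists2 f, f \in F Q P & im_group Q f = R) (R \in iso_class P F Q).
Proof.
move=> sQP; apply: (iffP idP) => [|[f fQP <-]]; rewrite inE.
  case/andP=> sRP /exists_inP[f fQR /exists_inP[g gRQ /andP[_ /eqP fgE]]].
  have fR := subsetP (fus_sub sQP sRP fQR).
  have gQ := subsetP (fus_sub sRP sQP gRQ).
  exists f; first exact: fus_widen fQR.
  apply: val_inj; rewrite /= (im_groupE (fus_injhoms sQP sRP fQR)).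
  apply/setP=> y; apply/idP/idP=> [/fR // | Ry].
  have /= fgy := restr_eq_in fgE Ry; rewrite -fgy.
  by rewrite imset_f // gQ ?imset_f.
have fim_sub := im_group_sub (fus_sub sQP (subxx P) fQP).
have [fim [g gF fg]] := sat_iso satF sQP (subxx P) fQP.
by rewrite fim_sub; apply/exists_inP; exists f; last by apply/exists_inP; exists g.
Qed.

Lemma im_group_comp Q R f g :
    f \in injhoms Q R ->
  im_group (im_group Q f) g = im_group Q (restr Q (g \o f)).
Proof.
move=> fQR; apply: val_inj; congr <<_>>.
by rewrite (im_groupE fQR) imset_restr imset_comp.
Qed.

(** A member of the class of [Q] with largest normalizer also has the largest
    normalizer in its own class, as morphisms compose. *)
Lemma exists_fully_normalized Q :
    Q \subset P ->
  exists f, f \in F Q P /\ fully_normalized P F (im_group Q f).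
Proof.
move=> sQP; have Q_Q: Q \in iso_class P F Q.
  apply/(iso_classP _ sQP); exists (incl Q); first by apply: (sat_incl satF).
  by apply: val_inj; rewrite /= imset_restr imset_id genGid.
have [R /(iso_classP _ sQP)[f fQP imf] maxR] : exists2 R : {group gT},
    R \in iso_class P F Q
    & forall S, S \in iso_class P F Q -> #|'N_P(S)| <= #|'N_P(R)|.
  by case: (arg_maxnP (fun R : {group gT} => #|'N_P(R)|) Q_Q) => R; exists R.
exists f; split=> //; apply/forall_inP=> S; have fI := fus_injhoms sQP (subxx P) fQP.
have sfP := im_group_sub (fus_sub sQP (subxx P) fQP).
case/(iso_classP _ sfP)=> g gfP <-; rewrite imf; apply: maxR.
apply/(iso_classP _ sQP); exists (restr Q (g \o f)).
  by apply: (cat_comp catF sQP sfP (subxx P)) gfP; case: (sat_iso satF sQP (subxx P) fQP).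
by rewrite -imf (im_group_comp _ fI).
Qed.

(** * Frobenius' criterion *)

Definition conj_induced Q f := exists2 x, x \in P & f = restr Q (conjg^~ x).

(** Here [a] is the conjugate by [f] of the action of [x] on [Q]. When all
    [F]-automorphisms of the image come from [P], [mem_extender] applies to
    every such [x], so the extender is the whole normalizer of [Q]. *)
Lemma fus_conj_transport Q f x :
    Q \subset P -> f \in F Q P -> x \in 'N_P(Q) ->
  exists2 a : {perm gT}, a \in Aut_fus F (im_group Q f)
    & {in Q, forall z, f (z ^ x) = a (f z)}.
Proof.
move=> sQP fQP NPx; have sRP := im_group_sub (fus_sub sQP (subxx P) fQP).
have [fQR [g gRQ /andP[/eqP gfE _]]] := sat_iso satF sQP (subxx P) fQP.
have Ac: conj_aut Q x \in Aut_conj P Q by apply/Aut_conjP; exists x.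
have /setIdP[_ cF] := subsetP (Aut_conj_sub_fus sQP) _ Ac.
have hF := cat_comp catF sRP sQP sRP (cat_comp catF sRP sQP sQP gRQ cF) fQR.
have [a Aa aE] := injhoms_Aut (fus_injhoms sRP sRP hF).
exists a; first by apply/setIdP; rewrite aE.
move=> z Qz; have Rfz: f z \in im_group Q f by rewrite mem_gen ?imset_f.
have /= gfz := restr_eq_in gfE Qz.
rewrite -(restrE a Rfz) aE restrE //= restrE //= gfz restrE //.
by rewrite norm_conj_autE //; case/setIP: NPx.
Qed.

Section LargerSubgroups.

Variable Q : {group gT}.
Hypotheses (pP : p.-group P) (prQP : Q \proper P).
Hypothesis larger : forall S f,
  S \subset P -> #|Q| < #|S| -> f \in F S P -> conj_induced S f.

Let sQP := proper_sub prQP.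

(** Normalizers grow in [P], so the extension lives on a larger subgroup. *)
Lemma conj_induced_of_extension f :
    f \in F Q P -> fully_normalized P F (im_group Q f) ->
    'N_P(Q) \subset extender P Q f ->
  conj_induced Q f.
Proof.
move=> fQP fn sNE; have [g gF <-] := sat_extend satF sQP fQP fn.
have sEP: extender_group P Q f \subset P.
  by apply/subsetP=> x; rewrite inE => /andP[/setIP[]].
have prQN := nilpotent_proper_norm (pgroup_nil pP) prQP.
have prQE := proper_sub_trans prQN sNE.
have [x Px ->] := larger sEP (proper_card prQE) gF.
exists x => //; apply: eq_in_restr => z Qz.
by rewrite restrE ?(subsetP (proper_sub prQE)).
Qed.

(** An [F]-automorphism normalizing [Aut_conj P Q] has the whole of ['N_P(Q)]
    as its extender, so it extends and is induced by [P]. Thus [Aut_conj P Q] is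
    self-normalizing in a p-group. *)
Lemma fully_normalized_Aut_fus :
    fully_normalized P F Q -> p.-group (Aut_fus F Q) ->
  Aut_fus F Q \subset Aut_conj P Q.
Proof.
move=> fn pA; pose A := Group (Aut_fus_group_set sQP).
have AcE: A :=: Aut_conj P Q; last by rewrite -AcE.
apply: (@nilpotent_sub_norm _ A [group of Aut_conj P Q]).
- exact: (@pgroup_nil _ p A).
- exact: Aut_conj_sub_fus.
apply/subsetP=> a /setIP[/setIdP[Aa aF] Na].
have aQP := fus_widen sQP (subxx P) sQP aF.
have aI := fus_injhoms sQP (subxx P) aQP.
have imE := im_group_Aut Aa.
case: (@conj_induced_of_extension (restr Q a)) => //; first by rewrite imE.
  apply/subsetP=> x NPx; have [Px Nx] := setIP NPx.
  have: conj_aut Q x ^ a \in Aut_conj P Q.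
    by rewrite memJ_norm //; apply/Aut_conjP; exists x.
  case/Aut_conjP=> y NPy cxa; apply: (mem_extender (y := y) aI NPx).
    by rewrite imE.
  move=> z Qz; have [_ Ny] := setIP NPy.
  rewrite !restrE ?memJ_norm // -(norm_conj_autE Nx Qz).
  by rewrite -(norm_conj_autE Ny) ?Aut_closed // -cxa conjgE !permM permK.
by move=> x Px; apply: Aut_conj_restr.
Qed.

End LargerSubgroups.

Lemma Frobenius_conj_induced :
    p.-group P -> (forall Q, Q \subset P -> p.-group (Aut_fus F Q)) ->
  forall Q f, Q \subset P -> f \in F Q P -> conj_induced Q f.
Proof.
move=> pP pAut Q; have [n] := ubnP (#|P| - #|Q|).
elim: n Q => // n IHn Q ltn f sQP fQP.
have larger R S g : #|R| = #|Q| -> S \subset P -> #|R| < #|S| -> g \in F S P ->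
  conj_induced S g.
- move=> oR sSP ltRS; apply: IHn => //; rewrite oR in ltRS.
  apply: leq_trans (ltn_sub2l _ ltRS) _ => //.
  exact: leq_trans ltRS (subset_leq_card sSP).
have [eqQP|prQP] := eqVproper sQP.
  have defQ: Q = P by apply: val_inj.
  rewrite {}defQ in fQP *.
  have [a Aa fE] := injhoms_Aut (fus_injhoms (subxx P) (subxx P) fQP).
  have /Aut_conjP[x /setIP[Px Nx] def_a]: a \in Aut_conj P P.
    have -> : Aut_conj P P = Aut_fus F P.
      pose A := Group (Aut_fus_group_set (subxx P)).
      exact: (@pHall_id _ p [group of Aut_conj P P] A) (sat_Sylow satF) (pAut _ _).
    by apply/setIdP; rewrite fE.
  exists x => //; rewrite -fE; apply: eq_in_restr => z Pz.
  by rewrite def_a norm_conj_autE.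
(* Morphisms onto a fully normalized group extend, so are conjugations.       *)
have to_fn S g : #|S| = #|Q| -> S \subset P -> g \in F S P ->
  fully_normalized P F (im_group S g) -> conj_induced S g.
- move=> oS sSP gSP fn; have gI := fus_injhoms sSP (subxx P) gSP.
  have sRP := im_group_sub (fus_sub sSP (subxx P) gSP).
  have oR: #|im_group S g| = #|Q|.
    have [_ gi _ _] := injhomsP _ _ _ gI.
    by rewrite (im_groupE gI) card_in_imset.
  have proper_oQ (T : {group gT}) : #|T| = #|Q| -> T \subset P -> T \proper P.
    by move=> oT sTP; rewrite properEcard sTP oT proper_card.
  have prR := proper_oQ _ oR sRP.
  have autR := fully_normalized_Aut_fus pP prR (fun T h => larger _ T h oR) fn
    (pAut _ sRP).
  apply: (conj_induced_of_extension pP (proper_oQ _ oS sSP)) fn _ => //.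
    by move=> T h; apply: larger.
  apply/subsetP=> x NPx; have [a Fa gxa] := fus_conj_transport sSP gSP NPx.
  have /Aut_conjP[y NPy def_a] := subsetP autR a Fa.
  apply: (mem_extender (y := y) gI NPx) => // z Sz.
  rewrite gxa // def_a norm_conj_autE //; first by case/setIP: NPy.
  by rewrite (im_groupE gI) imset_f.
have fI := fus_injhoms sQP (subxx P) fQP.
have sfP := im_group_sub (fus_sub sQP (subxx P) fQP).
have ofQ: #|im_group Q f| = #|Q|.
  by have [_ fi _ _] := injhomsP _ _ _ fI; rewrite (im_groupE fI) card_in_imset.
have [_ [g gF /andP[/eqP/restr_eq_in/= gfE _]]] := sat_iso satF sQP (subxx P) fQP.
have [h [hQP hfn]] := exists_fully_normalized sQP.
have [x Px /ffunP hx] := to_fn Q h erefl sQP hQP hfn.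
(* Composing h with the inverse of f reaches the same fully normalized group  *)
(* from the image of f, so f is a quotient of two conjugations.               *)
have kF := cat_comp catF sfP sQP (subxx P) gF hQP.
have [|y Py /ffunP ky] := to_fn _ _ ofQ sfP kF.
  rewrite (_ : im_group _ _ = im_group Q h) //; apply: val_inj; congr <<_>>.
  rewrite imset_restr (im_groupE fI) -imset_comp; apply: eq_in_imset => z Qz /=.
  by rewrite gfE.
exists (x * y^-1); first by rewrite groupM ?groupV.
have [_ _ _ <-] := injhomsP _ _ _ fI; apply: eq_in_restr => z Qz.
have fz: f z \in im_group Q f by rewrite mem_gen ?imset_f.
have := ky (f z); rewrite !restrE //= gfE // hx restrE // => zx.
by rewrite conjgM zx conjgK.
Qed.


Lemma Frobenius_trivial :
    p.-group P -> (forall Q, Q \subset P -> p.-group (Aut_fus F Q)) ->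
  same_on P F (conj_homs P).
Proof.
move=> pP pAut Q R sQP sRP; apply/eqP; rewrite eqEsubset (sat_conj satF) // andbT.
apply/subsetP=> f fQR; have fR := fus_sub sQP sRP fQR.
have fQP := fus_widen sQP (subxx P) sRP fQR.
have [x Px fE] := Frobenius_conj_induced pP pAut sQP fQP.
apply/imsetP; exists x => //; rewrite inE Px; move: fR.
by rewrite fE imset_restr.
Qed.

(** Each morphism is the restriction of an automorphism of [P], which is the
    extension required for [P] to be normal; [P] is its only isomorphic
    image, hence is centric. *)
Lemma constrained_aut_system (A : {set {perm gT}}) :
  A \subset Aut P -> same_on P (aut_system A) F -> constrained P F.
Proof.
move=> sAP EF; have NPP: 'N_P(P) = P by apply/setIidPl/normG.
exists P; split=> //.
- move=> R; rewrite inE => /andP[sRP /exists_inP[f fPR _]].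
  have [_ fi fR _] := injhomsP _ _ _ (fus_injhoms (subxx P) sRP fPR).
  have <-: P = R; last exact: subsetIl.
  apply: val_inj; apply/esym/eqP; rewrite eqEcard sRP.
  by rewrite -(card_in_imset fi) subset_leq_card.
- move=> R S sRP sSP; apply/setP=> f; rewrite inE andb_idr // -EF //.
  case/aut_systemP=> a [Aa aRS ->]; have Pa := subsetP sAP a Aa.
  have aP: a @: P = P by rewrite -{2}(im_autm Pa) morphimEdom.
  have joinP (T : {group gT}) : T \subset P -> (P <*> T)%G = P.
    by move=> sTP; apply: val_inj; apply/joing_idPl.
  rewrite !joinP //; apply/exists_inP; exists (restr P a).
    by rewrite -EF //; apply/aut_systemP; exists a; rewrite aP.
  rewrite imset_restr aP eqxx andbT; apply/eqP/eq_in_restr => x Rx.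
  by rewrite restrE ?(subsetP sRP).
Qed.

End Saturated.

(** * Automizers that are not p-groups *)

Section PrimeToP.

Variable p : nat.

Lemma pgroup_or_p'elt (gT : finGroupType) (G : {group gT}) :
  p.-group G \/ exists a, [/\ a \in G, p^'.-elt a & a != 1].
Proof.
have [/exists_inP[a Ga /andP[pa na]]|noa] :=
  boolP [exists a in G, p^'.-elt a && (a != 1)]; first by right; exists a.
left; apply/pgroupP=> q q_pr /(Cauchy q_pr)[a Ga oa]; apply: contraR noa => qp.
apply/exists_inP; exists a => //.
by rewrite -order_gt1 oa prime_gt1 // /p_elt oa pnatE // inE /= qp.
Qed.

(** The quotient of the generated group by the normal subgroup of inner
    automorphisms is an image of the p'-group generated by [a]. *)
Lemma Sylow_inner (gT : finGroupType) (Q : {group gT}) (a : {perm gT}) :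
    p.-group Q -> a \in Aut Q -> p^'.-elt a ->
  p.-Sylow(Aut_conj Q Q <*> <[a]>) (Aut_conj Q Q).
Proof.
move=> pQ Aa p'a; have nIa: <[a]> \subset 'N(Aut_conj Q Q).
  by rewrite cycle_subG (subsetP (Aut_norm_inner Q)).
rewrite /pHall joing_subl pgroup_Aut_conj //= -card_quotient; last first.
  by rewrite join_subG normG.
by rewrite quotientYidl //; apply: quotient_pgroup.
Qed.

End PrimeToP.

Lemma same_on_decidable (gT : finGroupType) (P : {group gT}) (E F : hom_family gT) :
  decidable (same_on P E F).
Proof.
apply: (@decP _ [forall Q : {group gT}, forall R : {group gT},
  (Q \subset P) && (R \subset P) ==> (E Q R == F Q R)]).
apply: (iffP forallP) => [EF Q R sQP sRP | EF Q].
  by have /forallP/(_ R) := EF Q; rewrite sQP sRP => /eqP.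
by apply/forallP=> R; apply/implyP=> /andP[sQP sRP]; apply/eqP/EF.
Qed.

(** A nontrivial p'-automorphism [a] of [Q] yields a nontrivial saturated
    subsystem on [Q], which extreme sparsity forces to be the whole of [F]. *)
Lemma extremely_sparse_aut (gT : finGroupType) (p : nat) (P Q : {group gT})
    (F : hom_family gT) (a : {perm gT}) :
    p.-group P -> extremely_sparse p P F -> Q \subset P ->
    a \in Aut_fus F Q -> p^'.-elt a -> a != 1 ->
  constrained P F.
Proof.
move=> pP [satF _ sparseF] sQP Fa p'a nta.
have pQ := pgroupS sQP pP; have [Aa _] := setIdP Fa.
pose A := ([group of Aut_conj Q Q] <*> <[a]>)%G.
have sAF: A \subset Aut_fus F Q.
  pose B := Group (Aut_fus_group_set satF sQP).
  rewrite -[Aut_fus F Q]/(gval B) join_subG cycle_subG Fa andbT.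
  apply: subset_trans (Aut_conj_sub_fus satF sQP).
  by apply: morphimS; apply: setSI.
have sAQ: A \subset Aut Q.
  by apply: subset_trans sAF _; apply/subsetP=> b /setIdP[].
have Aa_gen: a \in A by rewrite mem_gen // inE cycle_id orbT.
have subE: sat_subsystem p P F Q (aut_system A).
  split=> //; first exact: aut_system_saturated sAQ (Sylow_inner pQ Aa p'a).
  by move=> R S; apply: (aut_system_sub satF sQP sAF).
(* Equality of two systems concerns finitely many subgroups, so is decidable. *)
have [PE | nPE] : (Q = P /\ same_on P (aut_system A) F)
               \/ ~ (Q = P /\ same_on P (aut_system A) F).
- have [defQ|/eqP nQP] := eqVneq Q P; last by right; case.
  by case: (same_on_decidable P (aut_system A) F); [left | right; case].
- have [defQ EF] := PE; apply: (constrained_aut_system satF) EF.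
  by rewrite -defQ.
case/negP: nta; have trivE := sparseF _ _ subE nPE.
(* Otherwise the system of A is trivial, so a is inner and thus a p-element.  *)
have: a \in Aut_conj Q Q.
  have: restr Q a \in aut_system A Q Q.
    by apply/aut_systemP; exists a; rewrite -{2}(im_autm Aa) morphimEdom.
  rewrite trivE // => /imsetP[x /setIdP[Qx _]].
  exact: Aut_conj_restr.
move/(mem_p_elt (pgroup_Aut_conj Q pQ)) => pa.
by rewrite -order_eq1 (pnat_1 pa p'a).
Qed.

Theorem theorem5p2 (gT : finGroupType) (p : nat) (P : {group gT})
    (F : hom_family gT) :
  prime p -> p.-group P -> extremely_sparse p P F -> constrained P F.
Proof.
move=> _ pP sparseF; have [satF ntF _] := sparseF.
have [/exists_inP[Q sQP /exists_inP[a Fa /andP[p'a nta]]]|noQa] :=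
  boolP [exists Q : {group gT} in [pred Q : {group gT} | Q \subset P],
           [exists a in Aut_fus F Q, p^'.-elt a && (a != 1)]].
  exact: extremely_sparse_aut pP sparseF sQP Fa p'a nta.
case: ntF; apply: Frobenius_trivial pP _ => // Q sQP.
have [//|[a [Fa p'a nta]]] := pgroup_or_p'elt p (Group (Aut_fus_group_set satF sQP)).
case/exists_inP: noQa; exists Q => //.
by apply/exists_inP; exists a; rewrite ?p'a.
Qed.
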